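(* The set $\mathcal{B}$ has natural density zero: \[ \lim_{x \to +\infty} \frac{|\mathcal{B} \cap [1,x]|}{x} = 0. \] Consequently, the proportion of integers $n \equiv 1 \pmod 4$ possessing at least one prime divisor $p \equiv 3 \pmod 4$ tends to $1$: \[ \lim_{x \to +\infty} \frac{|\mathcal{A} \cap [1,x]|}{|\{ n \in \mathbb{N} : 1 \le n \le x,\ n \equiv 1 \pmod 4 \}|} = 1. \]
   Context: Let $\mathbb{P}$ denote the set of prime numbers, and define \[ \mathcal{A} = \{ n \ge 1 : n \equiv 1 \pmod 4,\ \exists p \in \mathbb{P},\ p \equiv 3 \pmod 4,\ p \mid n \}, \] \[ \mathcal{B} = \{ n \ge 1 : n \equiv 1 \pmod 4,\ \forall p \in \mathbb{P},\ (p \mid n \Rightarrow p \equiv 1 \pmod 4) \}, \] where $n$ ranges over integers. *)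

(* Defs.v *)
From HB Require Import structures.
From mathcomp Require Import all_boot all_order all_algebra finmap.
From mathcomp Require Import all_classical all_reals all_analysis.

Set Implicit Arguments.
Unset Strict Implicit.
Unset Printing Implicit Defensive.

Import Order.TTheory GRing.Theory Num.Theory.
Import numFieldNormedType.Exports.

Local Open Scope classical_set_scope.
Local Open Scope ring_scope.

(* The integers considered are all >= 1, so they are represented in nat. *)

Definition one_mod4 : set nat :=
  [set n | (1 <= n)%N /\ n = 1 %[mod 4]].

Definition calA : set nat :=
  [set n | [/\ (1 <= n)%N, n = 1 %[mod 4] &
    exists p : nat, [/\ prime p, p = 3 %[mod 4] & (p %| n)%N]]].

Definition calB : set nat :=
  [set n | [/\ (1 <= n)%N, n = 1 %[mod 4] &
    forall p : nat, prime p -> (p %| n)%N -> p = 1 %[mod 4]]].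

(* |S `&` [1, x]| for real x; fset_set is meaningful here because
   S `&` [1, x] is always finite. *)
Definition count_upto (R : realType) (S : set nat) (x : R) : nat :=
  #|` fset_set (S `&` [set n : nat | 1 <= (n%:R : R) <= x]) |%fset.

(* Main.v *)
Require Import Defs.
From HB Require Import structures.
From mathcomp Require Import all_boot all_order all_algebra finmap.
From mathcomp Require Import all_classical all_reals all_analysis.
From mathcomp Require Import zify ring lra.

Set Implicit Arguments.
Unset Strict Implicit.
Unset Printing Implicit Defensive.

Import Order.TTheory GRing.Theory Num.Theory.
Import numFieldNormedType.Exports.

Local Open Scope classical_set_scope.
Local Open Scope ring_scope.

(** Let S be the set of primes p <= N with p <> 1 mod 4, and Q their product.
    Every element of [calB] is coprime to Q, so the upper density of [calB] is
    at most phi(Q)/Q = prod_(p in S) (1 - 1/p), and it suffices that this product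
    tends to 0.  Let chi be the nontrivial character mod 4; its partial sums
    sum_(n <= x) chi(n)/n lie in [0, 1].  Changing the value of a completely
    multiplicative function at one prime p from c, |c| <= 1, to 1 multiplies a
    uniform bound on such sums by at most (1 - 1/p)^-2.  Doing this for all p in
    S turns chi into a function equal to 1 on [1, N], whence
    sum_(n <= N) 1/n <= prod_(p in S) (1 - 1/p)^-2, and the harmonic series
    diverges. *)

(** * The nontrivial character modulo 4 *)

Definition chi4 (R : pzRingType) (n : nat) : R :=
  if (n %% 4 == 1)%N then 1 else if (n %% 4 == 3)%N then -1 else 0.

Lemma chi4M (R : pzRingType) (m n : nat) :
  chi4 R (m * n)%N = chi4 R m * chi4 R n.
Proof.
rewrite /chi4 -(modnMm m n).
have: (m %% 4 < 4)%N by rewrite ltn_mod.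
have: (n %% 4 < 4)%N by rewrite ltn_mod.
move: (m %% 4)%N (n %% 4)%N => [|[|[|[|//]]]] [|[|[|[|//]]]] _ _ /=;
  by rewrite ?(mul0r, mulr0, mulr1, mul1r, mulrNN).
Qed.

Lemma chi4_norm_le1 (R : numDomainType) (n : nat) : `|chi4 R n| <= 1.
Proof. by rewrite /chi4; do 2?case: ifP => _; rewrite ?normrN ?normr1 ?normr0. Qed.

(* Completely multiplicative: it forgets the primes of [s], i.e. sends them to
   1, and agrees with [chi4] at the other primes. *)
Definition chi4_off (R : pzRingType) (s : seq nat) (n : nat) : R :=
  chi4 R (n`_[predC s])%N.

(** * Sums of [f n / n] and their uniform bounds *)

Definition lsum (R : unitRingType) (f : nat -> R) (x : nat) : R :=
  \sum_(1 <= n < x.+1) f n / n%:R.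

Lemma lsumS (R : unitRingType) (f : nat -> R) (x : nat) :
  lsum f x.+1 = lsum f x + f x.+1 / x.+1%:R.
Proof. by rewrite /lsum big_nat_recr. Qed.

Lemma sum_multiples (V : nmodType) (F : nat -> V) (p x : nat) : (0 < p)%N ->
  \sum_(1 <= n < x.+1 | (p %| n)%N) F n = \sum_(1 <= m < (x %/ p).+1) F (p * m)%N.
Proof.
move=> p0; elim: x => [|x IHx]; first by rewrite div0n !big_geq.
rewrite big_mkcond big_nat_recr //= -big_mkcond IHx divnS //.
case: ifP => [/dvdnP[k xk]|_]; last by rewrite add0n addr0.
rewrite add1n [in RHS]big_nat_recr //=; congr (_ + F _).
suff <- : k = (x %/ p).+1 by rewrite mulnC.
have := divnS x p0; rewrite xk dvdn_mull // mulnK // => ->; exact: add1n.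
Qed.

Lemma lsum_dilate (R : fieldType) (f : nat -> R) (p : nat) (c : R) (x : nat) :
    (0 < p)%N -> (forall m, (0 < m)%N -> f (p * m)%N = c * f m) ->
  lsum f x = \sum_(1 <= n < x.+1 | ~~ (p %| n)%N) f n / n%:R
             + c / p%:R * lsum f (x %/ p).
Proof.
move=> p0 fp; rewrite /lsum (bigID (fun n => p %| n)%N) /= addrC; congr +%R.
rewrite sum_multiples // mulr_sumr; apply: eq_big_nat => m /andP[m0 _].
by rewrite fp // natrM invfM; ring.
Qed.

(** The next block of four adds [1/(4k+1) - 1/(4k+3)], which is nonnegative. The sharp upper bound
    makes the induction close: the new sum is at most [1 - 1/(4k+3)], hence at most
    [1 - 1/(4k+5)]. *)
Lemma lsum_chi4_bounds (R : realFieldType) (k : nat) :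
  0 <= lsum (chi4 R) (4 * k) <= 1 - (4 * k).+1%:R^-1.
Proof.
elim: k => [|k /andP[IH0 IH1]].
  by rewrite muln0 /lsum big_geq // invr1 subrr lexx.
have -> : (4 * k.+1 = (4 * k).+4)%N by lia.
rewrite !lsumS; set t := lsum _ _ in IH0 IH1 *.
have -> : chi4 R (4 * k).+1 = 1 by rewrite /chi4; case: eqP => //; lia.
have -> : chi4 R (4 * k).+2 = 0.
  by rewrite /chi4; case: eqP; [lia|]; case: eqP => //; lia.
have -> : chi4 R (4 * k).+3 = -1.
  by rewrite /chi4; case: eqP; [lia|]; case: eqP => //; lia.
have -> : chi4 R (4 * k).+4 = 0.
  by rewrite /chi4; case: eqP; [lia|]; case: eqP => //; lia.
rewrite !mul0r !addr0 mul1r mulN1r.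
have anti a b : (a <= b)%N -> b.+1%:R^-1 <= a.+1%:R^-1 :> R.
  by move=> ab; rewrite lef_pV2 ?posrE ?ltr0n // ler_nat.
have h1 := anti (4 * k)%N (4 * k).+2 ltac:(lia).
have h2 := anti (4 * k).+2 (4 * k).+4 ltac:(lia).
move: h1 h2 IH1; move: (4 * k).+1%:R^-1 (4 * k).+3%:R^-1 (4 * k).+4.+1%:R^-1 => u v w h1 h2 IH1.
by apply/andP; split; lra.
Qed.

Lemma lsum_chi4_le1 (R : realFieldType) (x : nat) : `|lsum (chi4 R) x| <= 1.
Proof.
have /andP[h0 h1] := lsum_chi4_bounds R (x %/ 4).
have /andP[h2 h3] := lsum_chi4_bounds R (x %/ 4).+1.
have e4 : (4 * (x %/ 4).+1 = (4 * (x %/ 4)).+4)%N by lia.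
move: h2 h3; rewrite e4.
have := divn_eq x 4; have := ltn_pmod x (isT : 0 < 4)%N.
move: (x %% 4)%N => r; rewrite mulnC; set q := (4 * _)%N in h0 h1 *.
have c1 : chi4 R q.+1 = 1 by rewrite /chi4; case: eqP => //; lia.
have c2 : chi4 R q.+2 = 0.
  by rewrite /chi4; case: eqP; [lia|]; case: eqP => //; lia.
have c4 : chi4 R q.+4 = 0.
  by rewrite /chi4; case: eqP; [lia|]; case: eqP => //; lia.
rewrite ler_norml.
move=> r4 -> h2 h3; apply/andP; move: h1 h2 h3.
have : 0 <= q.+1%:R^-1 :> R by rewrite invr_ge0.
have : 0 <= q.+4.+1%:R^-1 :> R by rewrite invr_ge0.
case: r r4 => [|[|[|[|//]]]] _; rewrite ?addn0 ?addn1 ?addn2 ?addn3.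
- move: q.+1%:R^-1 q.+4.+1%:R^-1 => u v; by split; lra.
- rewrite (lsumS _ q) c1 div1r.
  move: q.+1%:R^-1 q.+4.+1%:R^-1 => u v; by split; lra.
- rewrite (lsumS _ q.+1) (lsumS _ q) c1 c2 mul0r addr0 div1r.
  move: q.+1%:R^-1 q.+4.+1%:R^-1 => u v; by split; lra.
(* As [chi4] vanishes at [q + 4], the sum up to [q + 3] equals the one over the completed block. *)
- rewrite (lsumS _ q.+3) c4 mul0r addr0.
  move: q.+1%:R^-1 q.+4.+1%:R^-1 => u v; by split; lra.
Qed.

(* [f] and [g] agree off the multiples of [p], hence
   lsum f x - lsum f (x / p) / p = lsum g x - c * lsum g (x / p) / p,
   and the bound propagates by strong induction on [x]. *)
Lemma lsum_local_factor (R : realFieldType) (f g : nat -> R) (p : nat) (c M : R) :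
    (1 < p)%N -> `|c| <= 1 ->
    (forall m, (0 < m)%N -> f (p * m)%N = f m) ->
    (forall m, (0 < m)%N -> g (p * m)%N = c * g m) ->
    (forall m, (0 < m)%N -> ~~ (p %| m)%N -> f m = g m) ->
    (forall x, `|lsum g x| <= M) ->
  forall x, `|lsum f x| <= M / (1 - p%:R^-1) ^+ 2.
Proof.
move=> p1 c1 fp gp fg gM.
set a : R := p%:R^-1.
have a0 : 0 < a by rewrite invr_gt0 ltr0n; lia.
have a1 : a < 1 by rewrite invf_lt1 ?ltr1n // ltr0n; lia.
have M0 : 0 <= M by apply: le_trans (gM 0%N).
have d0 : 0 < 1 - a by lra.
set K := M / _.
(* [K] must absorb one turn of the recursion. Equality would hold for [M * (1 + a) / (1 - a)], and
   [K] is at least that because [(1 - a) * (1 + a) <= 1]. *)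
have KM : M * (1 + a) + a * K <= K.
  have -> : M = K * (1 - a) ^+ 2 by rewrite /K divfK // expf_neq0 // gt_eqF.
  have K0 : 0 <= K by rewrite divr_ge0 // exprn_ge0 // ltW.
  have -> : K * (1 - a) ^+ 2 * (1 + a) + a * K
    = K - K * ((1 - a) * (a ^+ 2)) by ring.
  by rewrite gerBl (mulr_ge0 K0) // (mulr_ge0 (ltW d0)) ?sqr_ge0.
have p0 : (0 < p)%N by lia.
have fp1 m : (0 < m)%N -> f (p * m)%N = 1 * f m by move=> m0; rewrite fp ?mul1r.
have step x : lsum f x = lsum g x - c * a * lsum g (x %/ p) + a * lsum f (x %/ p).
  rewrite [LHS](lsum_dilate x p0 fp1) (lsum_dilate x p0 gp) -/a div1r -/a.
  rewrite [_ + c / _ * _ - _]addrK; congr (_ + _).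
  rewrite big_nat_cond [RHS]big_nat_cond; apply: eq_bigr => n /andP[/andP[n0 _] pn].
  by rewrite fg.
elim/ltn_ind => x IHx; case: x IHx => [_|x IHx].
  by rewrite /lsum big_geq // normr0 divr_ge0 // exprn_ge0 // ltW.
rewrite step; apply: le_trans KM.
apply: le_trans (ler_normD _ _) _; apply: lerD; last first.
  by rewrite normrM (gtr0_norm a0) ler_pM2l // IHx // ltn_Pdiv.
apply: le_trans (ler_normB _ _) _; rewrite mulrDr mulr1; apply: lerD => //.
rewrite !normrM (gtr0_norm a0) [M * a]mulrC; apply: ler_pM => //.
- by rewrite mulr_ge0 // ltW.
- by rewrite ler_piMl // ltW.
Qed.

(** Induction on [s]: adjoining [p] changes the value at [p] from [chi4 R p] to 1, at the cost of
    one local factor. Uniqueness ensures that [p] was not already altered. *)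
Lemma lsum_chi4_off_le (R : realFieldType) (s : seq nat) (x : nat) :
    uniq s -> all prime s ->
  `|lsum (chi4_off R s) x| <= \prod_(p <- s) (1 - p%:R^-1) ^- 2.
Proof.
elim: s x => [|p s IHs] x /=.
  move=> _ _; rewrite big_nil.
  rewrite [lsum _ _](_ : _ = lsum (chi4 R) x) ?lsum_chi4_le1 //.
  apply: eq_big_nat => n /andP[n0 _]; rewrite /chi4_off part_pnat_id //.
  by apply/pnatP.
case/andP => ps us /andP[pp ss]; rewrite big_cons mulrC.
have p0 := prime_gt0 pp.
apply: (@lsum_local_factor _ _ (chi4_off R s) p (chi4 R p)).
- exact: prime_gt1.
- exact: chi4_norm_le1.
- move=> m m0; rewrite /chi4_off partnM // (@part_p'nat _ p) ?mul1n //.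
  by rewrite pnatE // !inE eqxx.
- move=> m m0; rewrite /chi4_off partnM // chi4M (part_pnat_id (n := p)) //.
  by rewrite pnatE // inE.
- move=> m m0 pm; rewrite /chi4_off; congr chi4; apply: eq_in_partn => q.
  rewrite !inE mem_primes => /and3P[_ _ qm].
  by case: eqP => // qp; rewrite -qp qm in pm.
- by move=> y; apply: IHs.
Qed.

(** * The primes up to [N] not congruent to 1 modulo 4 *)

Lemma modn4_eq1_prime_divisors (n : nat) : (0 < n)%N ->
  (forall p, prime p -> (p %| n)%N -> p = 1 %[mod 4]) -> n = 1 %[mod 4].
Proof.
elim/ltn_ind: n => n IHn n0 nP; have [n1|n1] := leqP n 1%N.
  by have -> : n = 1%N by lia.
have [p pp pn] : exists2 p, prime p & (p %| n)%N.
  by exists (pdiv n); rewrite ?pdiv_prime ?pdiv_dvd.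
have /dvdnP[m nm] := pn.
have m0 : (0 < m)%N by lia.
have mn : (m < n)%N by rewrite nm ltn_Pmulr // prime_gt1.
have m4 : m = 1 %[mod 4].
  by apply: IHn => // q pq qm; apply: nP => //; rewrite nm dvdn_mulr.
by rewrite nm -modnMm m4 (nP p pp pn).
Qed.

Definition primes_ne1 (N : nat) : seq nat :=
  [seq p <- iota 0 N.+1 | prime p & (p %% 4 != 1)%N].

Lemma mem_primes_ne1 (N p : nat) :
  (p \in primes_ne1 N) = [&& prime p, (p %% 4 != 1)%N & (p <= N)%N].
Proof. by rewrite mem_filter mem_iota add0n ltnS -andbA. Qed.

Lemma primes_ne1_uniq (N : nat) : uniq (primes_ne1 N).
Proof. by rewrite filter_uniq ?iota_uniq. Qed.

Lemma primes_ne1_prime (N : nat) : all prime (primes_ne1 N).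
Proof. by apply/allP => p; rewrite mem_primes_ne1 => /andP[]. Qed.

(** Prime divisors of [n] are at most [N], so those surviving the removal of the listed primes are
    all 1 modulo 4, and so is their product. *)
Lemma chi4_off_primes_ne1 (R : pzRingType) (N n : nat) :
  (0 < n <= N)%N -> chi4_off R (primes_ne1 N) n = 1.
Proof.
case/andP=> n0 nN; rewrite /chi4_off /chi4.
set d := (n`_ _)%N.
suff -> : d = 1 %[mod 4] by [].
apply: modn4_eq1_prime_divisors; first exact: part_gt0.
move=> p pp pd; have := pnatP _ (part_gt0 [predC primes_ne1 N] n) (part_pnat _ n).
move=> /(_ p pp pd); rewrite !inE mem_primes_ne1 pp /=.
have -> : (p <= N)%N.
  by apply: leq_trans nN; apply: dvdn_leq n0 _; apply: dvdn_trans pd (dvdn_part _ _).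
by rewrite andbT negbK => /eqP ->.
Qed.

Lemma harmonic_le_primes_ne1 (R : realFieldType) (N : nat) :
  \sum_(1 <= n < N.+1) n%:R^-1 <= \prod_(p <- primes_ne1 N) (1 - p%:R^-1 : R) ^- 2.
Proof.
apply: le_trans (lsum_chi4_off_le R N (primes_ne1_uniq N) (primes_ne1_prime N)).
apply: le_trans (ler_norm _); rewrite le_eqVlt; apply/orP; left; apply/eqP.
by apply: eq_big_nat => n nN; rewrite chi4_off_primes_ne1 ?mul1r.
Qed.

(** * The totient ratio of a product of distinct primes *)

Lemma coprime_prod_primes (s : seq nat) (n : nat) :
  all prime s -> coprime (\prod_(p <- s) p) n = all (fun p => ~~ (p %| n)%N) s.
Proof.
elim: s => [|p s IHs] /=; first by rewrite big_nil coprime1n.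
by case/andP => pp ss; rewrite big_cons coprimeMl IHs // prime_coprime.
Qed.

Lemma totient_prod_primes (R : numFieldType) (s : seq nat) :
    uniq s -> all prime s ->
  (totient (\prod_(p <- s) p))%:R / (\prod_(p <- s) p)%:R
  = \prod_(p <- s) (1 - p%:R^-1) :> R.
Proof.
elim: s => [|p s IHs] /=; first by rewrite !big_nil divr1.
case/andP => ps us /andP[pp ss]; rewrite !big_cons totient_coprime.
  rewrite -IHs // totient_prime // !natrM invfM mulrACA; congr (_ * _).
  have p0 := prime_gt0 pp.
  by rewrite -subn1 natrB // mulrBl divff ?div1r // pnatr_eq0 -lt0n.
rewrite coprime_sym coprime_prod_primes //; apply/allP => q qs.
rewrite dvdn_prime2 //; last exact: (allP ss).
by apply: contra ps => /eqP <-.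
Qed.

Lemma totient_ratio_small (R : realType) (e : R) : 0 < e -> exists N,
  (totient (\prod_(p <- primes_ne1 N) p))%:R / (\prod_(p <- primes_ne1 N) p)%:R <= e.
Proof.
move=> e0.
have h : series (@harmonic R) @ \oo --> +oo.
  apply: nondecreasing_dvgn_lt; last exact: dvg_harmonic.
  by apply/nondecreasing_seqP => n; rewrite -subr_ge0 seriesSB ltW // harmonic_gt0.
(* With [P] the Euler product, the harmonic sum is at most [P ^- 2]; once it reaches [e ^- 2],
   [P <= e] follows. *)
have [N _ /(_ N (leqnn N)) HN] := (cvgryPge _).1 h (e ^- 2).
exists N; rewrite totient_prod_primes ?primes_ne1_uniq ?primes_ne1_prime //.
set P := \prod_(p <- _) _.
have P0 : 0 < P.
  rewrite /P big_seq; apply: prodr_gt0 => p; rewrite mem_primes_ne1 => /andP[pp _].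
  by rewrite subr_gt0 invf_lt1 ?ltr1n ?ltr0n ?prime_gt1 ?prime_gt0.
have : e ^- 2 <= P ^- 2.
  apply: le_trans HN _.
  have := harmonic_le_primes_ne1 R N.
  rewrite prodfV prodrXl -/P; apply: le_trans.
  by rewrite /series /= big_add1.
by rewrite lef_pV2 ?posrE ?exprn_gt0 // ler_sqr ?nnegrE ?(ltW P0) ?(ltW e0).
Qed.

(** * Counting integers in intervals *)

Lemma count_periodic (P : pred nat) (a q k : nat) : (forall n, P (q + n)%N = P n) ->
  count P (iota a (k * q)) = (k * count P (iota a q))%N.
Proof.
move=> Pq; have Pkq j n : P (j * q + n)%N = P n.
  by elim: j => [|j IHj]; rewrite ?add0n // mulSn -addnA Pq.
elim: k => [|k IHk]; first by rewrite !mul0n.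
rewrite !mulSn addnC iotaD count_cat IHk addnC; congr addn.
by rewrite addnC iotaDl count_map; apply: eq_count => n /=; rewrite Pkq.
Qed.

(** The interval is enlarged to start at 0 and to consist of whole periods of length [Q], each with
    [totient Q] coprime residues. *)
Lemma count_coprime_le (Q m : nat) : (0 < Q)%N ->
  (count (coprime Q) (iota 1 m) <= (m %/ Q).+1 * totient Q)%N.
Proof.
move=> Q0.
have cQ : count (coprime Q) (iota 0 Q) = totient Q.
  by rewrite totient_count_coprime -sum1_count big_mkcond /index_iota subn0.
rewrite -cQ -count_periodic => [|n]; last first.
  by rewrite -coprime_modr modnDl coprime_modr.
have mQ : (1 + m <= (m %/ Q).+1 * Q)%N by rewrite add1n ltn_ceil.
by rewrite -(subnKC mQ) !iotaD !count_cat add0n; lia.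
Qed.

Lemma count_mod4_ge (m : nat) : (m %/ 4 <= count (fun n => n %% 4 == 1)%N (iota 1 m))%N.
Proof.
rewrite {2}(divn_eq m 4) iotaD count_cat count_periodic => [|n]; last by rewrite modnDl.
by rewrite muln1 leq_addr.
Qed.

Lemma count_upto_count (R : realType) (S : set nat) (P : pred nat) (x : R) :
    0 <= x -> (forall n, (0 < n)%N -> S n <-> P n) ->
  count_upto S x = count P (iota 1 (Num.truncn x)).
Proof.
move=> x0 SP; rewrite /count_upto.
have -> : S `&` [set n : nat | 1 <= (n%:R : R) <= x]
    = [set` [fset n in [seq n <- iota 1 (Num.truncn x) | P n]]%fset].
  apply/seteqP; split=> n /=; rewrite !inE mem_filter mem_iota add1n ltnS truncn_ge_nat //.
    by case=> Sn; rewrite ler1n => /andP[n0 nx]; rewrite n0 nx !andbT; apply/SP.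
  by case/and3P => Pn n0 nx; split; [apply/SP | rewrite ler1n n0].
by rewrite set_fsetK card_fseq undup_id ?size_filter // filter_uniq ?iota_uniq.
Qed.

(** * Densities of the two sets *)

Definition calBb (n : nat) : bool := (n %% 4 == 1)%N && `[< calB n >].

Lemma calB_count (R : realType) (x : R) : 0 <= x ->
  count_upto calB x = count calBb (iota 1 (Num.truncn x)).
Proof.
move=> x0; apply: count_upto_count => // n n0; rewrite /calBb; split.
  by move=> Bn; case: (Bn) => _ n4 _; rewrite n4 /=; apply/asboolP.
by case/andP => _ /asboolP.
Qed.

Lemma one_mod4_count (R : realType) (x : R) : 0 <= x ->
  count_upto one_mod4 x = count (fun n => n %% 4 == 1)%N (iota 1 (Num.truncn x)).
Proof.
move=> x0; apply: count_upto_count => // n n0.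
by split=> [[_ ->]//|/eqP n4]; split.
Qed.

(** The two sets partition [one_mod4]: such an [n] is odd, so each of its prime divisors is 1 or 3
    modulo 4. *)
Lemma calA_calB_count (R : realType) (x : R) : 0 <= x ->
  (count_upto calA x + count_upto calB x)%N = count_upto one_mod4 x.
Proof.
move=> x0; rewrite calB_count // one_mod4_count //.
rewrite (@count_upto_count _ _ [pred n | (n %% 4 == 1)%N & ~~ calBb n]) //.
  rewrite -(count_predUI _ calBb) -[RHS]addn0; congr addn.
    apply: eq_count => n /=; rewrite /calBb.
    by case: (n %% 4 == 1)%N => //=; rewrite orNb.
  rewrite (@eq_count _ _ pred0) ?count_pred0 // => n /=.
  by rewrite -andbA andNb andbF.
move=> n n0 /=; split.
  case=> _ n4 [p [pp p3 pn]]; rewrite n4 /= /calBb n4 /=; apply/asboolPn => -[_ _ nB].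
  by have := nB p pp pn; rewrite p3.
case/andP => /[dup] n1 /eqP n4; rewrite /calBb n1 /= => /asboolPn nB; split=> //.
apply: contrapT => noA; apply: nB; split=> // p pp pn.
have /dvdnP[m nm] := pn.
have p3 : (p %% 4)%N <> 3%N by move=> p3; apply: noA; exists p; split.
have p0 : odd p.
  have : odd n by rewrite -(odd_mod n (erefl : odd 4 = false)) n4.
  by rewrite nm oddM => /andP[].
have : odd (p %% 4) by rewrite odd_mod.
by have := ltn_pmod p (isT : 0 < 4)%N; case: (p %% 4)%N p3 => [|[|[|[|]]]].
Qed.

Lemma calB_density (R : realType) :
  (count_upto calB x)%:R / (x : R) @[x --> +oo%R] --> (0 : R).
Proof.
apply/cvgrPdist_le => e e0.
have e20 : 0 < e / 2 by rewrite divr_gt0.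
have [N] := totient_ratio_small e20.
set Q := (\prod_(p <- _) p)%N => QN.
have Q0 : (0 < Q)%N.
  by rewrite /Q big_seq prodn_cond_gt0 // => p; rewrite mem_primes_ne1 => /andP[/prime_gt0].
near=> x.
have x0 : 0 < x by near: x; apply: nbhs_pinfty_gt; rewrite num_real.
(* Beyond this threshold the extra period, [totient Q], costs at most [e / 2 * x]; the other half of
   [e] bounds the full periods. *)
have xQ : (totient Q)%:R / (e / 2) <= x.
  by near: x; apply: nbhs_pinfty_ge; rewrite num_real.
rewrite sub0r normrN ger0_norm ?divr_ge0 // ?(ltW x0) // ler_pdivrMr //.
rewrite calB_count ?(ltW x0) //; set m := Num.truncn x.
have mx : m%:R <= x by rewrite truncn_le ltW.
have : (count calBb (iota 1 m) <= (m %/ Q).+1 * totient Q)%N.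
  apply: leq_trans (count_coprime_le m Q0); apply: sub_count => n.
  case/andP => _ /asboolP[n0 _ nB]; rewrite coprime_prod_primes ?primes_ne1_prime //.
  apply/allP => p; rewrite mem_primes_ne1 => /and3P[pp p1 _].
  by apply: contra p1 => pn; rewrite (nB p pp pn).
rewrite -(ler_nat R) natrM -(addn1 (m %/ Q)) natrD => /le_trans; apply.
have mQ : (m %/ Q)%:R <= x / Q%:R :> R.
  rewrite ler_pdivlMr ?ltr0n // -natrM; apply: le_trans mx.
  by rewrite ler_nat leq_trunc_div.
rewrite mulrDl mul1r; rewrite ler_pdivrMr // in xQ.
suff : (m %/ Q)%:R * (totient Q)%:R <= e / 2 * x by lra.
apply: le_trans (_ : x / Q%:R * (totient Q)%:R <= _).
  by rewrite ler_wpM2r.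
by rewrite -mulrA mulrC ler_pM2r // mulrC.
Unshelve. all: by end_near. Qed.

(** With [m] the integer part of [x], the count is at least [m %/ 4 >= 1], and [x < m + 1 <= 4 * (m
    %/ 4) + 4 <= 8 * (m %/ 4)]. *)
Lemma one_mod4_count_ge (R : realType) (x : R) : 4 <= x ->
  x <= 8 * (count_upto one_mod4 x)%:R.
Proof.
move=> x4; have x0 : 0 <= x by lra.
rewrite one_mod4_count //; set m := Num.truncn x.
have /andP[_ xm] : m%:R <= x < m.+1%:R by apply: truncn_itv.
have m4 : (4 <= m)%N by rewrite truncn_ge_nat.
apply: le_trans (ltW xm) _; rewrite -natrM ler_nat.
by have := count_mod4_ge m; lia.
Qed.

Theorem mainTheorem6 (R : realType) :
  ((count_upto calB x)%:R / (x : R) @[x --> +oo%R] --> (0 : R)) /\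
  ((count_upto calA (x : R))%:R / (count_upto one_mod4 x)%:R @[x --> +oo%R]
     --> (1 : R)).
Proof.
split; first exact: calB_density.
apply/cvgrPdist_le => e e0.
have e80 : 0 < e / 8 by rewrite divr_gt0.
(* The factor 8 pays for replacing [x] by the count of [one_mod4] in the denominator. *)
have /cvgrPdist_le/(_ _ e80) hB := @calB_density R.
near=> x.
have x4 : 4 <= x by near: x; apply: nbhs_pinfty_ge; rewrite num_real.
have x0 : 0 < x by lra.
have : `|0 - (count_upto calB x)%:R / x| <= e / 8 by near: x.
rewrite sub0r normrN ger0_norm ?divr_ge0 // ?(ltW x0) // ler_pdivrMr // => Bx.
have ox := one_mod4_count_ge x4.
have o0 : 0 < (count_upto one_mod4 x)%:R :> R by lra.
have AB := calA_calB_count (ltW x0).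
(* By the partition, the distance to 1 is the relative share of [calB]. *)
have -> : 1 - (count_upto calA x)%:R / (count_upto one_mod4 x)%:R
        = (count_upto calB x)%:R / (count_upto one_mod4 x)%:R :> R.
  rewrite -[X in X - _](divff (lt0r_neq0 o0)) -mulrBl; congr (_ / _).
  by rewrite -AB natrD addrC addKr.
rewrite ger0_norm ?divr_ge0 // ler_pdivrMr //; apply: le_trans Bx _.
by rewrite mulrAC -mulrA ler_pM2l // ler_pdivrMr // mulrC.
Unshelve. all: by end_near. Qed.
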